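(* Let $G$ be a graph. Then there exists a one-to-one correspondence between the set of all simple travel groupoids on $G$ and the set of all simple T-partition systems on $G$.
   Context: Graphs are undirected, possibly infinite, with no loops and no multiple edges; write $G=(V,E)$. A travel groupoid is a nonempty set $V$ with binary operation $*$ satisfying (t1) $(u*v)*u=u$ for all $u,v$ and (t2) if $(u*v)*v=u$ then $u=v$; it is on $G$ if $V(G)=V$ and $E(G)=\{\{u,v\}\mid u\neq v,\ u*v=v\}$; it is simple if for all $u,v$, $v*u\neq u$ implies $u*(v*u)=u*v$. For $u\in V$, $N_G[u]=\{u\}\cup\{v\mid\{u,v\}\in E\}$. A T-partition system on $G$ is a family $(V_{u,v}\subseteq V\mid (u,v)\in V\times V)$ such that: (P0) for every $u$, $\{V_{u,v}\mid v\in N_G[u]\}$ is a partition of $V$; (P1a) $V_{u,u}=\{u\}$; (P1b) for $u\neq v$: $v\in V_{u,v}$ iff $\{u,v\}\in E$; (P1c) for $u\neq v$: $V_{u,v}=\emptyset$ iff $\{u,v\}\notin E$; (P2) for $u\neq v$: $V_{u,v}\cap V_{v,u}=\emptyset$. It is simple if (R3): for all $u,v,x,y\in V$, if $u\in V_{v,x}$, $v\in V_{u,y}$, $u\neq x$, $v\neq y$, then $x\in V_{u,y}$ and $y\in V_{v,x}$. *)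

(* Defs.v *)
From mathcomp Require Import all_boot.
From mathcomp Require Export boolp classical_sets functions.

Set Implicit Arguments.
Unset Strict Implicit.
Unset Printing Implicit Defensive.

Local Open Scope classical_set_scope.

(* Edges are two-element sets, so a graph is undirected and has neither loops
   nor multiple edges; V may be infinite. *)
Record graph (V : Type) := Graph {
  edges :> set (set V);
  edgesP : forall e, edges e -> exists u v : V, u <> v /\ e = [set u; v]
}.

Definition adj (V : Type) (G : graph V) (u v : V) : Prop := edges G [set u; v].

Definition closed_neighborhood (V : Type) (G : graph V) (u : V) : set V :=
  [set u] `|` [set v | adj G u v].

Section Groupoids.
Variables (V : Type).
Implicit Types op : V -> V -> V.

Definition travel_groupoid op : Prop :=
  [/\ [set: V] !=set0,
      forall u v, op (op u v) u = u
    & forall u v, op (op u v) v = u -> u = v].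

Definition groupoid_on (G : graph V) op : Prop :=
  edges G = [set e | exists u v, [/\ u <> v, op u v = v & e = [set u; v]]].

Definition simple_groupoid op : Prop :=
  forall u v, op v u <> u -> op u (op v u) = op u v.

Definition simple_travel_groupoids_on (G : graph V) : set (V -> V -> V) :=
  [set op | [/\ travel_groupoid op, groupoid_on G op & simple_groupoid op]].

End Groupoids.

Section TPartitionSystems.
Variables (V : Type) (G : graph V).
Implicit Types P : V -> V -> set V.

(* [partition] is that of an indexed family: blocks with distinct indices
   v, w in N_G[u] are disjoint, hence distinct.  Read instead as a statement
   about the mere set of blocks, this would allow two indices to share a
   block, and the triangle would carry several simple T-partition systems
   but only one travel groupoid. *)
Definition T_partition_system P : Prop :=
  [/\ forall u, partition (closed_neighborhood G u) (P u) [set: V],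
      forall u, P u u = [set u],
      forall u v, u <> v -> (P u v v <-> adj G u v),
      forall u v, u <> v -> (P u v = set0 <-> ~ adj G u v)
    & forall u v, u <> v -> P u v `&` P v u = set0].

Definition simple_system P : Prop :=
  forall u v x y, P v x u -> P u y v -> u <> x -> v <> y ->
    P u y x /\ P v x y.

Definition simple_T_partition_systems_on : set (V -> V -> set V) :=
  [set P | T_partition_system P /\ simple_system P].

End TPartitionSystems.

(* Main.v *)
(** A travel groupoid and a T-partition system encode the same data: [op u w] is
    the neighbour of [u] through which one travels from [u] to [w], and
    [V_{u,v}] collects the targets [w] reached from [u] through [v].  The
    correspondence sends an operation [op] to the fibres of the maps [op u],
    that is, to [V_{u,v} = {w | op u w = v}]; conversely (P0) lets one define
    [op u w] as the index of the unique block at [u] containing [w].  Under it,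
    (R3) is the simplicity law applied to both [(u, v)] and [(v, u)]. *)

Require Import Defs.
From mathcomp Require Import ssreflect ssrfun ssrbool.
Local Open Scope classical_set_scope.

Lemma set2_inj {T : Type} {a b c d : T} :
  [set a; b] = [set c; d] -> (a = c /\ b = d) \/ (a = d /\ b = c).
Proof.
move=> E.
have [Ha Hb] : [set c; d] a /\ [set c; d] b by rewrite -E; split; [left|right].
have [Hc Hd] : [set a; b] c /\ [set a; b] d by rewrite E; split; [left|right].
by case: Ha Hb Hc Hd => /= [] ? [] /= ? [] /= ? [] /= ?; subst; auto.
Qed.

Lemma adj_sym {V : Type} (G : graph V) (u v : V) : adj G u v -> adj G v u.
Proof. by rewrite /adj setUC. Qed.

Lemma adj_neq {V : Type} (G : graph V) (u v : V) : adj G u v -> u <> v.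
Proof.
move=> uv E; have [a [b [ab]]] := edgesP uv.
by case/set2_inj => -[uE vE]; apply: ab; rewrite -uE -vE E.
Qed.

Section TravelGroupoid.
Context {V : Type} {op : V -> V -> V} (op_travel : travel_groupoid op).

Lemma travel_back u v : op (op u v) u = u.
Proof. by case: op_travel. Qed.

Lemma travel_inj u v : op (op u v) v = u -> u = v.
Proof. by case: op_travel => _ _; apply. Qed.

(** Two uses of (t1): writing the outer [u] as [op (op u w) u] makes the left side an instance of
    (t1) at [op u w]. Hence the first move out of [u] always follows an edge. *)
Lemma travel_step u w : op u (op u w) = op u w.
Proof. by rewrite -{1}(travel_back u w) travel_back. Qed.

Lemma travel_idem u : op u u = u.
Proof. by apply: travel_inj; rewrite travel_back. Qed.

Lemma travel_stay u w : op u w = u -> u = w.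
Proof. by move=> E; apply: travel_inj; rewrite !E. Qed.

Lemma travel_edge_sym u v : op u v = v -> op v u = u.
Proof. by move=> E; rewrite -{1}E travel_back. Qed.

Lemma travel_adj (G : graph V) u v : groupoid_on G op ->
  adj G u v <-> u <> v /\ op u v = v.
Proof.
rewrite /groupoid_on /adj => ->.
split=> [[a [b [ab ab_edge E]]]|[uv E]]; last by exists u, v.
case/set2_inj: E => [][-> ->]; split=> //; first exact: nesym.
exact: travel_edge_sym.
Qed.

End TravelGroupoid.

Definition fiber_system {V : Type} (op : V -> V -> V) (u v : V) : set V :=
  [set w | op u w = v].

Lemma fiber_system_inj {V : Type} : injective (@fiber_system V).
Proof.
move=> f g E; apply/funext => u; apply/funext => w.
have : fiber_system f u (f u w) w by [].
by rewrite E.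
Qed.

Lemma fiber_T_partition {V : Type} (G : graph V) (op : V -> V -> V) :
  travel_groupoid op -> groupoid_on G op ->
  T_partition_system G (fiber_system op).
Proof.
move=> tr /(travel_adj tr) adjP; split.
- move=> u; split.
  + rewrite -subTset => w _; exists (op u w) => //.
    have [->|uw] := pselect (op u w = u); first by left.
    by right; apply/adjP; rewrite travel_step//; split=> // /esym.
  + by move=> v w _ _ [x [<- <-]].
  + move=> v [->|/adjP[_ uv]]; first by exists u; exact: travel_idem.
    by exists v.
- move=> u; apply/seteqP; split=> w /=; first by move/(travel_stay tr).
  by move=> ->; exact: travel_idem.
- by move=> u v uv; rewrite adjP; split=> [|[]].
- move=> u v uv; rewrite adjP; split=> [E [_ uvv]|N].
    have : fiber_system op u v v by [].
    by rewrite E.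
  rewrite -subset0 => w uw; apply: N; split=> //.
  by rewrite -uw travel_step.
- move=> u v uv; rewrite -subset0 => w [uw vw].
  (* A common [w] gives [op (op v w) w = op u w = v], so (t2) applies. *)
  have vE : v = w by apply: (travel_inj tr); rewrite vw.
  by apply: uv; rewrite -vw -vE travel_idem.
Qed.

Lemma fiber_simple {V : Type} (op : V -> V -> V) :
  simple_groupoid op -> simple_system (fiber_system op).
Proof.
rewrite /simple_system /fiber_system => sm u v x y /= <- <- ux vy.
by split; apply: sm; apply: nesym.
Qed.

Section OperationOfSystem.
Context {V : Type} {G : graph V} {P : V -> V -> set V}.
Context (PT : T_partition_system G P).

(** By (P1c), blocks indexed outside the neighbourhood are empty, so the disjointness in (P0)
    extends to all indices. *)
Lemma block_index {u v w} : P u v w -> closed_neighborhood G u v.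
Proof.
case: PT => _ _ _ P1c _ uvw.
have [->|uv] := pselect (v = u); first by left.
right; apply: contrapT => /(P1c u v (nesym uv)) E.
by rewrite E in uvw.
Qed.

Lemma block_unique {u v v' w} : P u v w -> P u v' w -> v = v'.
Proof.
move=> h h'; case: PT => /(_ u)[_ tI _] _ _ _ _.
by apply: tI; [exact: block_index h|exact: block_index h'|exists w].
Qed.

Lemma block_exists u w : exists v, P u v w.
Proof.
case: PT => /(_ u)[cov _ _] _ _ _ _.
have : [set: V] w by [].
by rewrite -cov => -[v _ uvw]; exists v.
Qed.

Lemma block_adj u v : adj G u v -> P u v v.
Proof.
by move=> uv; case: PT => _ _ P1b _ _; apply/P1b => //; exact: adj_neq uv.
Qed.

Definition system_op (u w : V) : V := projT1 (cid (block_exists u w)).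

Lemma system_opP u v w : system_op u w = v <-> P u v w.
Proof.
rewrite /system_op; case: cid => v' /= h; split=> [<- //|].
exact: block_unique.
Qed.

Lemma fiber_system_op : fiber_system system_op = P.
Proof.
apply/funext => u; apply/funext => v; apply/seteqP.
by split=> w /system_opP.
Qed.

Lemma system_op_travel : [set: V] !=set0 -> travel_groupoid system_op.
Proof.
case: (PT) => _ P1a _ _ P2 V0; split=> // u v.
- have /system_opP uvx := erefl (system_op u v).
  move: uvx; set x := system_op u v => uvx; apply/system_opP.
  (* For (t1), [u] must lie in [P x u]: by (P1a) if [x = u], otherwise because adjacency is
     symmetric. *)
  case: (block_index uvx) => [->|ux]; first by rewrite P1a.
  by apply: block_adj; exact: adj_sym.
- have /system_opP uvx := erefl (system_op u v).
  move: uvx; set x := system_op u v => uxv /system_opP xuv.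
  (* For (t2), [v] lies in both [P u x] and [P x u]; (P2) forbids this unless [x = u], and then
     (P1a) yields [v = u]. *)
  have [xu|xu] := pselect (x = u).
    by move: uxv; rewrite xu P1a => /esym.
  have : (P u x `&` P x u) v by [].
  by rewrite P2//; exact: nesym.
Qed.

Lemma system_op_on : groupoid_on G system_op.
Proof.
case: (PT) => _ _ P1b _ _; apply/seteqP; split=> e.
  move=> Ge; have [u [v [uv E]]] := edgesP Ge.
  exists u, v; split=> //; apply/system_opP; apply: block_adj.
  by rewrite /adj -E.
by move=> [u [v [uv /system_opP uvv ->]]]; apply/(P1b u v uv).
Qed.

Lemma system_op_simple : simple_system P -> simple_groupoid system_op.
Proof.
case: (PT) => _ P1a P1b _ _ R3 u v vu; apply/system_opP.
have /system_opP vxu := erefl (system_op v u).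
have /system_opP uyv := erefl (system_op u v).
apply: (proj1 (R3 u v _ _ vxu uyv _ _)); first exact: nesym.
(* (R3) has two inequality premises, simplicity only one. The other follows: if [v] is its own block
   index at [u], then [u] and [v] are equal or adjacent, so [v] travels to [u] in one step, against
   [vu]. *)
move=> vE; apply: vu; apply/system_opP.
have [->|uv] := pselect (u = v); first by rewrite P1a.
by apply: block_adj; apply: adj_sym; apply/(P1b u v uv); rewrite -vE in uyv.
Qed.

End OperationOfSystem.

Theorem theorem4p5 (V : Type) (V_nonempty : [set: V] !=set0) (G : graph V) :
  exists f : (V -> V -> V) -> (V -> V -> set V),
    set_bij (simple_travel_groupoids_on G) (simple_T_partition_systems_on G) f.
Proof.
exists fiber_system; split.
- move=> op [tr on sm]; split; first exact: fiber_T_partition.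
  exact: fiber_simple.
- by move=> f g _ _; exact: fiber_system_inj.
(* Surjectivity uses [V_nonempty]: an empty carrier has a T-partition system but no travel
   groupoid. *)
- move=> P [PT R3]; exists (system_op PT); last exact: fiber_system_op.
  split; [exact: system_op_travel|exact: system_op_on|exact: system_op_simple].
Qed.
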